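(* Let $m\ge 1$ and $n>2$ be integers, and let $D_{2n}=\langle x,y \mid x^n=y^2=(xy)^2=1\rangle$ be the dihedral group with $2n$ elements. If $n$ is even, then $Der(\mathbb{F}_{2^m} D_{2n})$ is an $\mathbb{F}_{2^m}$-vector space of dimension $2n+4$ with basis $$\left\{ d_{x', y'} \mid (x',y') \in \{(\lambda y, 0),\ (x \omega y, \omega) \mid \lambda \in B_e(xy),\ \omega \in B_e(y)\} \right\},$$ where $$B_e(y) = \{1,\ x^{\frac{n}{2}},\ y,\ x^{\frac{n}{2}}y \} \cup \{x^i + x^{-i},\ (x^i + x^{-i})y \mid i = 1, 2, \dots, \tfrac{n}{2}-1\},$$ $$B_e(xy) = \{1,\ x^{\frac{n}{2}},\ xy,\ x^{\frac{n}{2}}xy \} \cup \{x^i + x^{-i},\ x(x^i + x^{-i})y \mid i = 1, 2, \dots, \tfrac{n}{2}-1\}.$$ If $n$ is odd, then $Der(\mathbb{F}_{2^m} D_{2n})$ is an $\mathbb{F}_{2^m}$-vector space of dimension $\frac{3n+1}{2}$ with basis the set of all $d_{x',y'}$ with $$(x',y') \in \left\{((x^i + x^{-i})y,\, 0),\ ((1+x)y,\, 1),\ (0,\, y),\ (x(x^i + x^{-i})y,\, x^i + x^{-i}),\ (0,\, (x^i + x^{-i})y) \;\middle|\; i = 1, \dots, \tfrac{n-1}{2}\right\}.$$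
   Context: $\mathbb{F}_{2^m}D_{2n}$ is the group algebra of $D_{2n}$ over the finite field with $2^m$ elements. A derivation of a ring $A$ is a map $d\colon A\to A$ with $d(a+b)=d(a)+d(b)$ and $d(ab)=d(a)b+a\,d(b)$ for all $a,b\in A$; $Der(A)$ is the set of all derivations of $A$. $Der(\mathbb{F}_{2^m}D_{2n})$ is an $\mathbb{F}_{2^m}$-vector space under pointwise addition and $(k d)(a)=k\,d(a)$. A derivation $d$ of $\mathbb{F}_{2^m}D_{2n}$ is uniquely determined by $d(x)$ and $d(y)$; $d_{x',y'}$ denotes the derivation $d$ with $d(x)=x'$ and $d(y)=y'$, where $x',y'\in\mathbb{F}_{2^m}D_{2n}$. (That a derivation $d_{x',y'}$ exists for each pair listed is part of the assertion.) *)

(* Defs.v *)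
From HB Require Import structures.
From mathcomp Require Import all_boot all_order all_algebra.
From mathcomp Require Import all_fingroup all_solvable all_field.

Set Implicit Arguments.
Unset Strict Implicit.
Unset Printing Implicit Defensive.

Import GRing.Theory.
Local Open Scope ring_scope.

(* The group algebra F[gT]: functions gT -> F, with pointwise addition and     *)
(* scaling and the convolution product. It is an alias of the finfun type      *)
(* because MathComp equips the latter with the pointwise product.              *)
Definition galg (F : fieldType) (gT : finGroupType) := {ffun gT -> F^o}.

HB.instance Definition _ (F : fieldType) (gT : finGroupType) :=
  Vector.copy (galg F gT) {ffun gT -> F^o}.

Section GroupAlgebra.
Variables (F : fieldType) (gT : finGroupType).
Implicit Types a b c : galg F gT.

Definition gelt (g : gT) : galg F gT := [ffun h => (h == g)%:R].

Definition galg_mul a b : galg F gT :=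
  [ffun g => \sum_(h : gT) (a h : F) * b (h^-1 * g)%g].

Lemma galg_mulE a b g :
  galg_mul a b g = \sum_(h : gT) (a h : F) * b (h^-1 * g)%g.
Proof. by rewrite ffunE. Qed.

Lemma galg_mulA : associative galg_mul.
Proof.
move=> a b c; apply/ffunP=> g; rewrite !galg_mulE.
under eq_bigr => h _ do rewrite galg_mulE mulr_sumr.
under [RHS]eq_bigr => h _ do rewrite galg_mulE mulr_suml.
rewrite [RHS]exchange_big /=; apply: eq_bigr => h _.
rewrite (reindex_inj (mulgI h^-1)%g) [RHS](reindex_inj (mulgI 1%g)) /=.
by apply: eq_bigr => k _; rewrite mul1g mulrA invMg invgK -!mulgA mulKVg.
Qed.

Lemma galg_mul1 : left_id (gelt 1) galg_mul.
Proof.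
move=> a; apply/ffunP=> g; rewrite galg_mulE (bigD1 1%g) //= big1 => [|h].
  by rewrite ffunE eqxx mul1r invg1 mul1g addr0.
by rewrite ffunE => /negPf->; rewrite mul0r.
Qed.

Lemma galg_mulr1 : right_id (gelt 1) galg_mul.
Proof.
move=> a; apply/ffunP=> g; rewrite galg_mulE (bigD1 g) //= big1 => [|h].
  by rewrite ffunE mulVg eqxx mulr1 addr0.
by rewrite ffunE -eq_mulVg1 => /negPf->; rewrite mulr0.
Qed.

Lemma galg_mulDl : left_distributive galg_mul +%R.
Proof.
move=> a b c; apply/ffunP=> g; rewrite [RHS]ffunE !galg_mulE -big_split /=.
by apply: eq_bigr => h _; rewrite ffunE mulrDl.
Qed.

Lemma galg_mulDr : right_distributive galg_mul +%R.
Proof.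
move=> a b c; apply/ffunP=> g; rewrite [RHS]ffunE !galg_mulE -big_split /=.
by apply: eq_bigr => h _; rewrite ffunE mulrDr.
Qed.

Lemma gelt1_neq0 : gelt 1 != 0.
Proof.
by apply/eqP => /ffunP/(_ 1%g)/eqP; rewrite !ffunE eqxx oner_eq0.
Qed.

HB.instance Definition _ := GRing.Zmodule_isNzRing.Build (galg F gT)
  galg_mulA galg_mul1 galg_mulr1 galg_mulDl galg_mulDr gelt1_neq0.

Lemma galg_scaleAl (k : F) a b : k *: (a * b) = (k *: a) * b.
Proof.
apply/ffunP=> g; rewrite ffunE !galg_mulE scaler_sumr.
by apply: eq_bigr => h _; rewrite ffunE [LHS]mulrA.
Qed.

HB.instance Definition _ :=
  GRing.Lmodule_isLalgebra.Build F (galg F gT) galg_scaleAl.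

Lemma galg_scaleAr (k : F) a b : k *: (a * b) = a * (k *: b).
Proof.
apply/ffunP=> g; rewrite ffunE !galg_mulE scaler_sumr.
by apply: eq_bigr => h _; rewrite ffunE [LHS]mulrCA.
Qed.

HB.instance Definition _ :=
  GRing.Lalgebra_isAlgebra.Build F (galg F gT) galg_scaleAr.

Lemma gelt1 : gelt 1 = 1. Proof. by []. Qed.

Lemma geltM (g h : gT) : gelt (g * h)%g = gelt g * gelt h.
Proof.
apply/ffunP=> k; rewrite galg_mulE (bigD1 g) //= big1 => [|l].
  by rewrite !ffunE eqxx mul1r addr0 (can2_eq (mulKVg g) (mulKg g)).
by rewrite !ffunE => /negPf->; rewrite mul0r.
Qed.

Lemma galg_sum a : a = \sum_g a g *: gelt g.
Proof.
apply/ffunP=> h; rewrite sum_ffunE (bigD1 h) //= big1 => [|g ne_gh].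
  by rewrite !ffunE eqxx addr0 [_ *: _]mulr1.
by rewrite !ffunE eq_sym (negPf ne_gh) scaler0.
Qed.

End GroupAlgebra.

Arguments gelt {F gT} g.

HB.instance Definition _ (F : finFieldType) (gT : finGroupType) :=
  Finite.copy (galg F gT) {ffun gT -> (F : finType)}.


(* Ring derivations: linearity over the base field is not required.            *)
Definition derivation (A : pzRingType) (d : A -> A) : Prop :=
  (forall a b, d (a + b) = d a + d b) /\
  (forall a b, d (a * b) = d a * b + a * d b).

Section Derivations.
Variables (F : finFieldType) (gT : finGroupType).
Local Notation A := (galg F gT).
Implicit Types d : {ffun A -> A}.

Definition derivationb d : bool :=
  [forall a, forall b, d (a + b) == d a + d b] &&
  [forall a, forall b, d (a * b) == d a * b + a * d b].

Lemma derivationP d : reflect (derivation d) (derivationb d).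
Proof.
apply: (iffP andP) => [[dD dM]|[dD dM]]; split.
- by move=> a b; apply/eqP; move/forallP/(_ a)/forallP: dD.
- by move=> a b; apply/eqP; move/forallP/(_ a)/forallP: dM.
- by apply/forallP=> a; apply/forallP=> b; rewrite dD.
- by apply/forallP=> a; apply/forallP=> b; rewrite dM.
Qed.

(* Der(F[gT]) as a subspace of all maps F[gT] -> F[gT]; the derivations are    *)
(* already closed under linear combinations, so the span adds nothing          *)
(* (mem_Der).                                                                  *)
Definition Der : {vspace {ffun A -> A}} :=
  <<enum [pred d : {ffun A -> A} | derivationb d]>>%VS.

Lemma derivation0 : derivation (0 : {ffun A -> A}).
Proof. by split=> a b; rewrite !ffunE ?mul0r ?mulr0 addr0. Qed.

Lemma derivationZD (k : F) d1 d2 :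
  derivation d1 -> derivation d2 -> derivation (k *: d1 + d2).
Proof.
move=> [D1 M1] [D2 M2]; split=> a b; rewrite !ffunE.
  by rewrite D1 D2 scalerDr addrACA.
rewrite M1 M2 scalerDr addrACA scalerAl scalerAr.
by rewrite mulrDl mulrDr.
Qed.

Lemma mem_Der d : d \in Der <-> derivation d.
Proof.
split=> [/coord_span->|der_d]; last first.
  by apply: memv_span; rewrite mem_enum inE; apply/derivationP.
elim/big_rec: _ => [|i d' _ der_d']; first exact: derivation0.
apply: derivationZD der_d'; apply/derivationP.
set e := enum_tuple _; have: e`_i \in e by apply: mem_nth; rewrite size_tuple.
by rewrite mem_enum.
Qed.

Section Generators.
Variables x y : gT.
Local Notation X := (gelt x : A).
Local Notation Y := (gelt y : A).

(* d_{x',y'}, with junk value 0 if there is no such derivation.                *)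
Definition der_at (p : A * A) : {ffun A -> A} :=
  odflt 0 [pick d in Der | (d X == p.1) && (d Y == p.2)].

Definition xsym (i : nat) : A := gelt (x ^+ i)%g + gelt (x ^- i)%g.

Definition Be_y (n : nat) : seq A :=
  [:: 1; X ^+ n./2; Y; X ^+ n./2 * Y]
  ++ [seq xsym i | i <- iota 1 n./2.-1]
  ++ [seq xsym i * Y | i <- iota 1 n./2.-1].

Definition Be_xy (n : nat) : seq A :=
  [:: 1; X ^+ n./2; X * Y; X ^+ n./2 * X * Y]
  ++ [seq xsym i | i <- iota 1 n./2.-1]
  ++ [seq X * xsym i * Y | i <- iota 1 n./2.-1].

Definition even_pairs (n : nat) : seq (A * A) :=
  [seq (l * Y, 0) | l <- Be_xy n] ++ [seq (X * w * Y, w) | w <- Be_y n].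

Definition odd_pairs (n : nat) : seq (A * A) :=
  [seq (xsym i * Y, 0) | i <- iota 1 n./2]
  ++ [:: ((1 + X) * Y, 1); (0, Y)]
  ++ [seq (X * xsym i * Y, xsym i) | i <- iota 1 n./2]
  ++ [seq (0, xsym i * Y) | i <- iota 1 n./2].

Definition Der_basis (s : seq (A * A)) : Prop :=
  (forall p, p \in s ->
     exists d : A -> A, [/\ derivation d, d X = p.1 & d Y = p.2]) /\
  basis_of Der [seq der_at p | p <- s].

End Generators.
End Derivations.

(* x and y generate gT and satisfy the dihedral relations; for gT = 'D_(2n)    *)
(* these are the pairs for which <x, y | x^n = y^2 = (xy)^2 = 1> is a          *)
(* presentation of gT.                                                         *)
Definition dihedral_generators (gT : finGroupType) (n : nat) (x y : gT) : Prop :=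
  [/\ <<[set x; y]>>%g = [set: gT], (x ^+ n = 1)%g, (y ^+ 2 = 1)%g
    & ((x * y) ^+ 2 = 1)%g].

Lemma dihedral_generators_exist (n : nat) : (1 < n)%N ->
  exists x y : 'D_(n.*2), dihedral_generators n x y.
Proof.
move=> n_gt1; have := Grp_dihedral n_gt1; move/isoGrp_hom/existsP=> [[x y]] /=.
case/eqP=> defG xn y2 xy; exists x, y; split=> //.
  by rewrite -defG joing_idl joing_idr.
have yV: (y^-1 = y)%g by apply/eqP; rewrite eq_invg_mul -(expgS y 1) y2.
by rewrite expgS expg1 -mulgA -{1}yV -conjgE xy mulgV.
Qed.

Section Uniqueness.
Variables (F : finFieldType) (gT : finGroupType) (x y : gT) (m n : nat).
Local Notation A := (galg F gT).
Hypotheses (oF : #|F| = (2 ^ m)%N) (gen_xy : dihedral_generators n x y).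
Implicit Types d : A -> A.

Lemma derivation_linear d : derivation d -> forall k u, d (k *: u) = k *: d u.
Proof.
move=> [dD dM] k u.
have m_gt0: (0 < m)%N.
  by case: m oF => // /eqP; rewrite eqn_leq leqNgt card_finNzRing_gt1.
have ch2: 2%N \in [pchar F] by apply: card_finPcharP oF _.
pose l := k ^+ (2 ^ m.-1).
have kl: k = l * l.
  by rewrite -expr2 -exprM mulnC -expnS prednK // -oF expf_card.
have dk: d k%:A = 0.
  rewrite kl -scalerA -[l%:A]mul1r scalerAl dM -scalerAl mul1r -scalerAr mulr1.
  by rewrite -mulr2n -scaler_nat (pcharf0 ch2) scale0r.
by rewrite -[k *: u]mulr_algl dM dk mul0r add0r mulr_algl.
Qed.

Lemma derivation_unique d1 d2 : derivation d1 -> derivation d2 ->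
  d1 (gelt x) = d2 (gelt x) -> d1 (gelt y) = d2 (gelt y) -> d1 =1 d2.
Proof.
move=> der1 der2 eqx eqy.
have [[D1 M1] [D2 M2]] := (der1, der2).
have d0 d : derivation d -> d 0 = 0.
  by case=> dD _; apply: (addrI (d 0)); rewrite -dD !addr0.
have d1_0 d : derivation d -> d 1 = 0.
  case=> _ dM; apply: (addrI (d 1)).
  by rewrite addr0 -{3}[1]mulr1 dM mulr1 mul1r.
pose E := [set g : gT | d1 (gelt g) == d2 (gelt g)].
have gE: group_set E.
  apply/group_setP; split=> [|g h]; rewrite !inE ?gelt1 ?d1_0 //.
  by move=> /eqP eg /eqP eh; rewrite geltM M1 M2 eg eh.
have Eg g : d1 (gelt g) = d2 (gelt g).
  have [defG _ _ _] := gen_xy; apply/eqP.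
  have: g \in <<[set x; y]>>%g by rewrite defG inE.
  have: (<<[set x; y]>> \subset Group gE)%g.
    by rewrite gen_subG; apply/subsetP=> z /set2P[]->; rewrite inE ?eqx ?eqy.
  by move/subsetP=> sE /sE; rewrite inE.
move=> a; rewrite [a]galg_sum.
elim/big_ind: _ => [|u v eu ev|g _]; first by rewrite !d0.
  by rewrite D1 D2 eu ev.
by rewrite !derivation_linear ?Eg.
Qed.

Lemma der_atE d (p : A * A) : derivation d ->
  d (gelt x) = p.1 -> d (gelt y) = p.2 -> der_at x y p =1 d.
Proof.
move=> der_d dx dy; rewrite /der_at; case: pickP => [d'|/(_ [ffun a => d a])].
  case/andP=> /mem_Der der_d' /andP[/eqP d'x /eqP d'y] /=.
  by apply: derivation_unique; rewrite ?dx ?dy.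
rewrite /= !ffunE dx dy !eqxx !andbT => /negbT/negP[]; apply/mem_Der.
by case: der_d => dD dM; split=> a b; rewrite !ffunE.
Qed.

End Uniqueness.

(* Main.v *)
From HB Require Import structures.
Require Import Defs.
From mathcomp Require Import all_boot all_order all_algebra.
From mathcomp Require Import all_fingroup all_solvable all_field.
From mathcomp Require Import zify.

Set Implicit Arguments.
Unset Strict Implicit.
Unset Printing Implicit Defensive.

Import GRing.Theory.
Local Open Scope ring_scope.

(** Let A be the group algebra, of characteristic 2. A derivation d is
    determined by d(x) and d(y), and a pair of values extends to a derivation
    exactly when differentiating the relations x^n = y^2 = (xy)^2 = 1 gives
    identities (dihedral_derivation_exists): over the dual numbers over A,
    presented here as triangular matrices, d is the same thing as a
    multiplicative map g |-> g + d(g) eps, and the dihedral group has the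
    universal property of its presentation (dihedral_universal).

    In characteristic 2 the relations y^2 = 1 and (xy)^2 = 1 say that d(y)
    commutes with y and d(xy) = d(x)y + x d(y) commutes with xy. The centralizer
    of a reflection has the sums over its conjugation orbits on the group as a
    basis (orbit_sum_expand, orbit_sum_free); for y these are the elements
    1, x^i + x^-i, x^(n/2) for n even, and their products with y. Since x, xy
    satisfy the same relations as x, y, the centralizer of xy needs no separate
    treatment.

    The evaluation d |-> d(y) maps Der(A) to the centralizer of y, and a
    derivation in its kernel is determined by d(x)y = d(xy), which commutes with
    xy. It therefore suffices to exhibit derivations whose values at y form a
    basis of the centralizer, together with a basis of the kernel
    (Der_basis_of_extension). What remains is the relation x^n = 1.

    For n even this relation imposes nothing: x^(n/2) is central, so the
    derivative of its square is 2 x^(n/2) d(x^(n/2)) = 0 (dual_X_even). The kernel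
    is then the whole centralizer of xy, and w |-> (xwy, w) lifts the
    centralizer of y.

    For n odd, write d(x) = f y + g with f and g combinations of rotations. The
    derivative of x^n = 1 is f N y + n x^(n-1) g = 0, where N is the sum of all
    rotations (rot_norm_mulY). Its two terms have disjoint supports, so g = 0
    and f has augmentation 0. On the kernel, where d(x) = mu y with mu in the
    centralizer of xy, only the combinations of the x^i + x^-i survive
    (derivation_ker_odd), while each element of the basis of the centralizer of y
    is still a value d(y): for 1, the choice f = x has to be corrected to
    1 + x in order to have augmentation 0. *)

(** * The dihedral relations as a presentation *)

Section DihedralGroup.

Variables (gT : finGroupType) (n : nat) (x y : gT).
Hypothesis gen_xy : dihedral_generators n x y.

Lemma dihedral_invy : (y^-1 = y)%g.
Proof. by have [_ _ y2 _] := gen_xy; apply/eqP; rewrite eq_invg_mul -y2. Qed.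

Lemma dihedral_conjXy i : ((x ^+ i) ^ y = x ^- i)%g.
Proof.
have [_ _ _ xy2] := gen_xy; rewrite conjXg -expgVn; congr (_ ^+ i)%g.
apply/esym/eqP; rewrite conjgE dihedral_invy eq_invg_mul.
by rewrite -xy2 expgS expg1 !mulgA.
Qed.

(** This symmetry carries every result about the reflection y over to the
    reflection xy. *)
Lemma dihedral_generators_mul : dihedral_generators n x (x * y)%g.
Proof.
have [defG xn y2 xy2] := gen_xy; split=> //; last first.
  rewrite mulgA expgS expg1 {2}[(x * x * y)%g]conjgC mulgA -(mulgA (x * x)%g y y).
  rewrite -[(y * y)%g](expgS y 1) y2 mulg1 -[(x * x)%g](expgS x 1).
  by rewrite dihedral_conjXy mulgV.
apply/eqP; rewrite -subTset -defG gen_subG; apply/subsetP=> z.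
have Hx : (x \in <<[set x; (x * y)%g]>>)%g by rewrite mem_gen ?set21.
by case/set2P=> -> //; rewrite -(groupMl _ Hx) mem_gen ?set22.
Qed.

Hypotheses (n_gt0 : (0 < n)%N) (oG : #|gT| = n.*2).

Lemma dihedral_expX_mod i : (x ^+ (i %% n) = x ^+ i)%g.
Proof. by have [_ xn _ _] := gen_xy; apply: expg_mod. Qed.

Lemma dihedral_invX i : (i <= n)%N -> (x ^- i = x ^+ (n - i))%g.
Proof.
have [_ xn _ _] := gen_xy; move=> le_in; apply/eqP.
by rewrite eq_invg_mul -expgD subnKC // xn.
Qed.

Lemma dihedral_repr g : exists k (b : bool), (k < n)%N /\ g = (x ^+ k * y ^+ b)%g.
Proof.
have [defG xn y2 _] := gen_xy.
have nXY : (<[y]> \subset 'N(<[x]>))%g.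
  rewrite cycle_subG; apply/normP.
  by rewrite -cycleJ -{1}[x]expg1 dihedral_conjXy cycleV.
have : g \in (<[x]> <*> <[y]>)%g by rewrite joing_idl joing_idr /joing defG inE.
rewrite norm_joinEr // => /mulsgP[_ _ /cycleP[i ->] /cycleP[j ->] ->].
exists (i %% n)%N, (odd j); split; first by rewrite ltn_mod.
by rewrite dihedral_expX_mod -modn2 (expg_mod j y2).
Qed.

(** There are 2n words in normal form and 2n group elements, so that a
    surjection between them is a bijection. *)
Lemma dihedral_repr_inj k l (b c : bool) :
  (x ^+ k * y ^+ b = x ^+ l * y ^+ c)%g -> k = l %[mod n] /\ b = c.
Proof.
pose e (p : 'I_n * bool) := (x ^+ p.1 * y ^+ p.2)%g.
have card_e : #|image e predT| == #|{: 'I_n * bool}|.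
  rewrite cardT -cardE card_prod card_ord card_bool muln2 -oG.
  apply/eqP/eq_card=> g; rewrite [RHS]inE.
  have [i [d [lt_in ->]]] := dihedral_repr g.
  by apply/codomP; exists (Ordinal lt_in, d).
have inj_e := image_injP card_e.
rewrite -(dihedral_expX_mod k) -(dihedral_expX_mod l) => eq_e.
have lt_n i : (i %% n < n)%N by rewrite ltn_mod.
by case: (inj_e (Ordinal (lt_n k), b) (Ordinal (lt_n l), c) isT isT eq_e).
Qed.

(** The universal property of the presentation. Normal forms are unique, so
    x^k y^b |-> u^k v^b is well defined; it is multiplicative because v moves past
    u in the ring by the same rule as y past x in the group. *)
Lemma dihedral_universal (B : nzRingType) (u v : B) :
    u ^+ n = 1 -> v ^+ 2 = 1 -> (u * v) ^+ 2 = 1 ->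
  exists phi : gT -> B,
    [/\ {morph phi : g h / (g * h)%g >-> g * h}, phi x = u & phi y = v].
Proof.
move=> un v2 uv2; have [_ xn y2 _] := gen_xy.
have u_mod i : u ^+ (i %% n) = u ^+ i.
  by rewrite [in RHS](divn_eq i n) exprD mulnC exprM un expr1n mul1r.
have v_odd (b c : bool) : v ^+ (b (+) c) = v ^+ b * v ^+ c.
  by case: b c => [] []; rewrite ?mul1r ?mulr1 // -expr2 v2.
have y_odd (b c : bool) : (y ^+ (b (+) c) = y ^+ b * y ^+ c)%g.
  by case: b c => [] []; rewrite ?mul1g ?mulg1 // -[RHS](expgS y 1) y2.
have vu i : v * u ^+ i = u ^+ (i * n.-1) * v.
  have vu1 : v * u = u ^+ n.-1 * v.
    rewrite -[v * u]mul1r -un -[in u ^+ n](prednK n_gt0) exprSr -!mulrA.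
    by congr (_ * _); rewrite -[RHS]mul1r -uv2 expr2 -!mulrA -expr2 v2 mulr1.
  elim: i => [|i IHi]; first by rewrite mulr1 mul1r.
  by rewrite exprS mulrA vu1 -mulrA IHi mulrA -exprD mulSn.
have yx i : (y * x ^+ i = x ^+ (i * n.-1) * y)%g.
  rewrite conjgCV dihedral_invy dihedral_conjXy mulnC expgM -subn1.
  by rewrite -dihedral_invX // expg1 expgVn.
have /fin_all_exists[r rP] : forall g, exists p : nat * bool,
    g = (x ^+ p.1 * y ^+ p.2)%g.
  by move=> g; have [k [b [_ ->]]] := dihedral_repr g; exists (k, b).
pose phi g := u ^+ (r g).1 * v ^+ (r g).2.
have phiE k (b : bool) : phi (x ^+ k * y ^+ b)%g = u ^+ k * v ^+ b.
  rewrite /phi; case: (dihedral_repr_inj (rP (x ^+ k * y ^+ b)%g)) => eq_k <-.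
  by rewrite -u_mod -eq_k u_mod.
exists phi; split; last 2 first.
- by rewrite -[x]expg1 -[(x ^+ 1)%g]mulg1 (phiE 1%N false) mulr1.
- by rewrite -[y]expg1 -[(y ^+ 1)%g]mul1g (phiE 0%N true) mul1r.
move=> g h.
have [k [b [_ ->]]] := dihedral_repr g; have [l [c [_ ->]]] := dihedral_repr h.
have -> : (x ^+ k * y ^+ b * (x ^+ l * y ^+ c) =
          x ^+ (k + (if b then l * n.-1 else l))%N * y ^+ (b (+) c))%g.
  rewrite y_odd expgD -!mulgA; congr (_ * _)%g; rewrite !mulgA; congr (_ * _)%g.
  by case: b; rewrite ?mul1g ?mulg1 // expg1 yx.
rewrite !phiE v_odd exprD -!mulrA; congr (_ * _); rewrite !mulrA; congr (_ * _).
by case: b; rewrite ?mul1r ?mulr1 // expr1 vu.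
Qed.

End DihedralGroup.

(** * The centralizer of an involution in a group algebra *)

Section OrbitSums.

Variables (F : fieldType) (gT : finGroupType).
Local Notation A := (galg F gT).
Implicit Types (a : A) (g h y : gT) (r : seq gT).

Lemma galg_mul_geltr a g h : (a * gelt g) h = a (h * g^-1)%g.
Proof.
rewrite [LHS]galg_mulE (bigD1 (h * g^-1)%g) //= big1 => [|k ne_k].
  by rewrite ffunE invMg invgK mulgKV eqxx mulr1 addr0.
rewrite ffunE; case: eqP => [def_g|]; last by rewrite mulr0.
by rewrite -def_g invMg invgK mulKVg eqxx in ne_k.
Qed.

Lemma galg_mul_geltl a g h : (gelt g * a) h = a (g^-1 * h)%g.
Proof.
rewrite [LHS]galg_mulE (bigD1 g) //= big1 => [|k ne_k].
  by rewrite ffunE eqxx mul1r addr0.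
by rewrite ffunE (negPf ne_k) mul0r.
Qed.

Lemma gelt_commP a g :
  reflect (forall h, a (h ^ g)%g = a h) (a * gelt g == gelt g * a).
Proof.
apply: (iffP eqP) => [ag h|aJ].
  by rewrite conjgE -galg_mul_geltl -ag galg_mul_geltr mulgK.
apply/ffunP=> h; rewrite galg_mul_geltr galg_mul_geltl -(aJ (h * g^-1)%g).
by rewrite conjgE mulgKV.
Qed.

Definition orbit_sum y g : A := [ffun h => (h \in [:: g; g ^ y]%g)%:R].

Lemma orbit_sum_fixed y g : (g ^ y)%g = g -> orbit_sum y g = gelt g.
Proof. by move=> gy; apply/ffunP=> h; rewrite !ffunE gy !inE orbb. Qed.

Lemma orbit_sum_moved y g :
  (g ^ y)%g != g -> orbit_sum y g = gelt g + gelt (g ^ y)%g.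
Proof.
move=> gy; apply/ffunP=> h; rewrite !ffunE !inE.
by have [->|] := eqVneq h g; rewrite ?add0r // eq_sym (negPf gy) addr0.
Qed.

Section Involution.

Variable y : gT.
Hypothesis yV : (y^-1 = y)%g.

Let yJ g : ((g ^ y) ^ y)%g = g.
Proof. by rewrite -{2}yV conjgK. Qed.

Lemma mem_orbitJ g h : (h ^ y \in [:: g; g ^ y])%g = (h \in [:: g; g ^ y]%g).
Proof.
by rewrite !inE orbC (inj_eq (conjg_inj y)) -(inj_eq (conjg_inj y) (h ^ y)%g) yJ.
Qed.

Lemma orbit_sum_comm g : orbit_sum y g * gelt y = gelt y * orbit_sum y g.
Proof. by apply/eqP/gelt_commP=> h; rewrite !ffunE mem_orbitJ. Qed.

Definition orbit_transversal r :=
  [/\ uniq r, forall h, exists2 g, g \in r & h \in [:: g; g ^ y]%g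
    & {in r &, forall g h, h \in [:: g; g ^ y]%g -> h = g}].

Variable r : seq gT.
Hypothesis trans_r : orbit_transversal r.

(** An element commutes with y exactly when its coefficients are constant on
    conjugation orbits, whence this expansion. *)
Lemma orbit_sum_expand a : a * gelt y = gelt y * a ->
  a = \sum_(g <- r) a g *: orbit_sum y g.
Proof.
have [uniq_r cover_r inj_r] := trans_r; move/eqP/gelt_commP=> aJ.
apply/ffunP=> h; rewrite sum_ffunE; have [g rg hg] := cover_r h.
rewrite (bigD1_seq g) //= big_seq_cond big1 => [|k /andP[rk ne_kg]].
  rewrite !ffunE hg addr0 [_ *: _]mulr1.
  by move: hg; rewrite !inE => /orP[] /eqP->.
rewrite !ffunE; case hk: (h \in _); last exact: scaler0.
case/eqP: ne_kg; apply: (inj_r g k) => //.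
move: hk; rewrite 2!inE => /orP[] /eqP def_h; move: hg; rewrite def_h //.
by rewrite mem_orbitJ.
Qed.

Lemma orbit_sum_free : free (map (orbit_sum y) r).
Proof.
have [uniq_r _ inj_r] := trans_r.
apply/(@freeP _ _ _ (map_tuple (orbit_sum y) (in_tuple r))) => k.
move/ffunP=> sum0 i; have := sum0 (tnth (in_tuple r) i).
have ri j : tnth (in_tuple r) j \in r by apply: mem_tnth.
rewrite sum_ffunE (bigD1 i) // big1 => [|j ne_ji].
  rewrite -tnth_nth tnth_map !ffunE mem_head /= addr0 => <-.
  by rewrite [RHS]mulr1.
rewrite -tnth_nth tnth_map !ffunE; case hj: (_ \in _); last exact: scaler0.
case/eqP: ne_ji; apply/esym; apply/tuple_uniqP: (inj_r _ _ (ri j) (ri i) hj).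
exact: uniq_r.
Qed.

End Involution.

End OrbitSums.

(** * Derivations as morphisms to dual numbers *)

Section DualMatrices.

Variable A : nzRingType.
Implicit Types (a b c e : A) (k : nat).

(** The dual number a + b eps over A, as an upper triangular matrix: d is a
    derivation exactly when a |-> dual_mx a (d a) is a ring morphism. *)
Definition dual_mx a b : 'M[A]_2 :=
  \matrix_(i, j) if i == j then a else if (i < j)%N then b else 0.

Lemma dual_mx1 : dual_mx 1 0 = 1.
Proof. by apply/matrixP=> i j; rewrite !mxE; case: eqP => // _; case: ifP. Qed.

Lemma dual_mxM a b c e : dual_mx a b * dual_mx c e = dual_mx (a * c) (a * e + b * c).
Proof.
apply/matrixP=> i j; rewrite !mxE !big_ord_recl big_ord0 !mxE addr0.
by case: i j => [[|[|[]]] //= ?] [[|[|[]]] //= ?];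
  rewrite ?mul0r ?mulr0 ?add0r ?addr0.
Qed.

Lemma dual_mx_inj a b c e : dual_mx a b = dual_mx c e -> a = c /\ b = e.
Proof. by move/matrixP=> E; have := (E 0 0, E 0 1); rewrite !mxE /= => -[]. Qed.

Lemma dual_mxX a b k :
  dual_mx a b ^+ k = dual_mx (a ^+ k) (\sum_(j < k) a ^+ j * b * a ^+ (k - j.+1)).
Proof.
elim: k => [|k IHk]; first by rewrite !expr0 big_ord0 dual_mx1.
rewrite exprS IHk dual_mxM -exprS big_ord_recl expr0 mul1r subn1 addrC.
congr (dual_mx _ (_ + _)); rewrite mulr_sumr; apply: eq_bigr => j _.
by rewrite !mulrA -exprS.
Qed.

Lemma derivation1 (d : A -> A) : derivation d -> d 1 = 0.
Proof.
case=> _ dM; apply: (addrI (d 1)).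
by rewrite addr0 -{3}[1]mulr1 dM mulr1 mul1r.
Qed.

Lemma derivation_dual_mxX (d : A -> A) a k : derivation d ->
  dual_mx a (d a) ^+ k = dual_mx (a ^+ k) (d (a ^+ k)).
Proof.
move=> der_d; elim: k => [|k IHk]; first by rewrite !expr0 derivation1 // dual_mx1.
by have [_ dM] := der_d; rewrite exprS IHk dual_mxM addrC -dM -exprS.
Qed.

End DualMatrices.

Section CocycleDerivation.

Variables (F : fieldType) (gT : finGroupType).
Local Notation A := (galg F gT).

(** The product rule is bilinear, so it suffices to have it on group elements. *)
Lemma derivation_of_cocycle (D : gT -> A) :
    (forall g h, D (g * h)%g = gelt g * D h + D g * gelt h) ->
  exists2 d : A -> A, derivation d & forall g, d (gelt g) = D g.
Proof.
move=> DM; pose d (a : A) := \sum_g a g *: D g.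
have dD a b : d (a + b) = d a + d b.
  by rewrite -big_split; apply: eq_bigr => g _; rewrite ffunE scalerDl.
have d0 : d 0 = 0 by apply: (addrI (d 0)); rewrite -dD !addr0.
have dZ k a : d (k *: a) = k *: d a.
  by rewrite scaler_sumr; apply: eq_bigr => g _; rewrite ffunE scalerA.
have dg g : d (gelt g) = D g.
  rewrite /d (bigD1 g) //= ffunE eqxx scale1r big1 ?addr0 // => h ne_hg.
  by rewrite ffunE (negPf ne_hg) scale0r.
exists d => //; split=> // a b; rewrite [a]galg_sum.
elim/big_ind: _ => [|u v du dv|g _]; first by rewrite d0 !mul0r d0 addr0.
  by rewrite mulrDl !dD du dv mulrDl [in RHS]mulrDl addrACA.
rewrite -scalerAl !dZ -!scalerAl -scalerDr; congr (_ *: _); rewrite [b]galg_sum.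
elim/big_ind: _ => [|u v du dv|h _]; first by rewrite d0 !mulr0 d0 addr0.
  by rewrite mulrDr !dD du dv mulrDr [in RHS]mulrDr addrACA.
by rewrite -scalerAr !dZ -!scalerAr -scalerDr -geltM !dg DM addrC.
Qed.

End CocycleDerivation.

Section DihedralDerivations.

Variables (F : fieldType) (gT : finGroupType) (n : nat) (x y : gT).
Hypotheses (gen_xy : dihedral_generators n x y).
Hypotheses (n_gt0 : (0 < n)%N) (oG : #|gT| = n.*2).
Local Notation A := (galg F gT).
Local Notation X := (gelt x : A).
Local Notation Y := (gelt y : A).

(** By the universal property, a derivation with prescribed values on x and y
    exists as soon as the corresponding dual numbers satisfy the dihedral
    relations. *)
Lemma dihedral_derivation_exists (p q : A) :
    dual_mx X p ^+ n = 1 -> dual_mx Y q ^+ 2 = 1 ->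
    (dual_mx X p * dual_mx Y q) ^+ 2 = 1 ->
  exists d : A -> A, [/\ derivation d, d X = p & d Y = q].
Proof.
move=> Xn Y2 XY2.
have [phi [phiM phix phiy]] := dihedral_universal gen_xy n_gt0 oG Xn Y2 XY2.
pose E := [set g | phi g == dual_mx (gelt g) (phi g 0 1)].
have EM g h : g \in E -> h \in E -> (g * h)%g \in E.
  rewrite !inE phiM => /eqP-> /eqP->; rewrite dual_mxM geltM; apply/eqP.
  by congr dual_mx; rewrite !mxE.
have phi1 : phi 1%g = 1.
  have [_ _ y2 _] := gen_xy.
  by rewrite -[1%g]y2 expgS expg1 phiM phiy -expr2.
have gE : group_set E.
  apply/group_setP; split=> [|g h]; last exact: EM.
  by rewrite inE phi1 -dual_mx1 gelt1; apply/eqP; congr dual_mx; rewrite mxE.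
have phiE g : phi g = dual_mx (gelt g) (phi g 0 1).
  have [defG _ _ _] := gen_xy; apply/eqP.
  suff: g \in Group gE by rewrite inE.
  have: g \in <<[set x; y]>>%g by rewrite defG inE.
  apply/subsetP; rewrite gen_subG; apply/subsetP=> z.
  by case/set2P=> ->; rewrite inE ?phix ?phiy; apply/eqP; congr dual_mx; rewrite mxE.
have [g h|d der_d dg] := @derivation_of_cocycle F gT (fun g => phi g 0 1).
  by rewrite phiM (phiE g) (phiE h) dual_mxM !mxE.
by exists d; rewrite !dg phix phiy !mxE.
Qed.

Hypothesis addAA : forall a : A, a + a = 0.

Lemma dihedral_derivation_exists_char2 (p q : A) :
    dual_mx X p ^+ n = 1 -> q * Y = Y * q ->
    (p * Y + X * q) * (X * Y) = X * Y * (p * Y + X * q) ->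
  exists d : A -> A, [/\ derivation d, d X = p & d Y = q].
Proof.
have [_ _ y2 xy2] := gen_xy => Xn qY pqXY.
apply: dihedral_derivation_exists => //.
  by rewrite expr2 dual_mxM qY addAA -geltM -(expgS y 1) y2 gelt1 dual_mx1.
rewrite expr2 !dual_mxM [X * q + _]addrC pqXY addAA -!geltM -(expgS _ 1) xy2.
by rewrite gelt1 dual_mx1.
Qed.

End DihedralDerivations.

(** * A basis of the derivations from the evaluation at y *)

Section FreeFamilies.

Variables (K : fieldType) (V W : vectType K) (f : 'Hom(V, W)).
Implicit Types s t : seq V.

Lemma free_preim s : free (map f s) -> free s.
Proof.
rewrite /free => /eqP; rewrite -limg_span size_map => dim_fs.
rewrite eqn_leq dim_span -dim_fs /=.
by rewrite -(limg_ker_dim f <<s>>) leq_addl.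
Qed.

(** Rank-nullity: the span of s ++ t meets the kernel in dimension at least
    size s, and its image has dimension size t. *)
Lemma free_cat_ker s t :
  {in s, forall v, f v = 0} -> free s -> free (map f t) -> free (s ++ t).
Proof.
rewrite /free => f0 /eqP dim_s /eqP dim_ft.
rewrite eqn_leq dim_span size_cat /= -dim_s -(size_map f t) -dim_ft.
rewrite -limg_span -(limg_ker_dim f <<s ++ t>>) leq_add ?dimvS //.
  rewrite subv_cap span_cat addvSl /=; apply/span_subvP=> v sv.
  by rewrite memv_ker f0.
by rewrite limgS // span_cat addvSr.
Qed.

End FreeFamilies.

Section DerivationBasis.

Variables (F : finFieldType) (gT : finGroupType) (x y : gT) (m n : nat).
Hypotheses (oF : #|F| = (2 ^ m)%N) (gen_xy : dihedral_generators n x y).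
Local Notation A := (galg F gT).
Local Notation X := (gelt x : A).
Local Notation Y := (gelt y : A).

(** Taking v = 1, u = y gives d |-> d(y); taking u = x, v = y gives d |-> d(xy) on
    the derivations that kill y. *)
Definition eval_mul (u v : A) (d : {ffun A -> A}) : A := d u * v.

Lemma eval_mul_is_linear u v : linear (eval_mul u v).
Proof. by move=> k d e; rewrite /eval_mul !ffunE mulrDl scalerAl. Qed.

HB.instance Definition _ u v :=
  GRing.isLinear.Build F {ffun A -> A} A _ (eval_mul u v) (@eval_mul_is_linear u v).

(** L is a basis of the values d(x)y on the derivations killing y, and Q lifts a
    basis of the values d(y): this is the exact sequence of the evaluation at y,
    read on bases. *)
Lemma Der_basis_of_extension (L : seq A) (Q : seq (A * A)) :
    (forall l, l \in L ->
       exists d : A -> A, [/\ derivation d, d X = l * Y & d Y = 0]) ->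
    (forall q, q \in Q ->
       exists d : A -> A, [/\ derivation d, d X = q.1 & d Y = q.2]) ->
    free L -> free (unzip2 Q) ->
    (forall d : A -> A, derivation d -> d Y = 0 -> d X * Y \in <<L>>%VS) ->
    (forall d : A -> A, derivation d -> d Y \in <<unzip2 Q>>%VS) ->
  \dim (Der F gT) = (size L + size Q)%N /\
  Der_basis x y ([seq (l * Y, 0) | l <- L] ++ Q).
Proof.
move=> derL derQ freeL freeQ spanL spanQ.
have [_ _ y2 _] := gen_xy.
have Y2 : Y * Y = 1 by rewrite -geltM -(expgS y 1) y2 gelt1.
set s := (_ ++ Q).
have ders p : p \in s ->
    exists d : A -> A, [/\ derivation d, d X = p.1 & d Y = p.2].
  by rewrite mem_cat => /orP[/mapP[l /derL[d [der_d dX dY]] ->]|/derQ] //; exists d.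
have derat p : p \in s ->
    [/\ derivation (der_at x y p), der_at x y p X = p.1 & der_at x y p Y = p.2].
  move=> /ders[d [der_d dX dY]]; have dE := der_atE oF gen_xy der_d dX dY.
  by split; rewrite ?dE //; split=> a b; rewrite !dE; case: der_d => dD dM.
pose fY := linfun (eval_mul Y 1); pose fX := linfun (eval_mul X Y).
have fYE d : fY d = d Y by rewrite lfunE /= /eval_mul mulr1.
have fXE d : fX d = d X * Y by rewrite lfunE.
pose sL := [seq der_at x y (l * Y, 0) | l <- L].
pose sQ := [seq der_at x y q | q <- Q].
have sE : [seq der_at x y p | p <- s] = sL ++ sQ by rewrite map_cat -map_comp.
have inL l : l \in L -> (l * Y, 0) \in s.
  by move=> Ll; rewrite mem_cat map_f.
have inQ q : q \in Q -> q \in s by move=> Qq; rewrite mem_cat Qq orbT.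
have fXL : map fX sL = L.
  rewrite -map_comp -[RHS]map_id; apply/eq_in_map=> l /inL/derat[_ /= dX _].
  by rewrite fXE dX -mulrA Y2 mulr1.
have fYQ : map fY sQ = unzip2 Q.
  by rewrite -map_comp; apply/eq_in_map=> q /inQ/derat[_ _ /= dY]; rewrite fYE dY.
have fYL : {in sL, forall d, fY d = 0}.
  by move=> _ /mapP[l /inL/derat[_ _ /= dY] ->]; rewrite fYE dY.
have sub_s : (<<sL ++ sQ>> <= Der F gT)%VS.
  apply/span_subvP=> d; rewrite -sE => /mapP[p /derat[der_p _ _] ->].
  exact/mem_Der.
have sup_s : (Der F gT <= <<sL ++ sQ>>)%VS.
  apply/subvP=> d /mem_Der der_d; rewrite span_cat.
  have: fY d \in (fY @: <<sQ>>)%VS by rewrite limg_span fYQ fYE spanQ.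
  case/memv_imgP=> e sQe; rewrite !fYE => eqY.
  have der_e : derivation e.
    by apply/mem_Der/(subvP sub_s); rewrite span_cat (subvP (addvSr _ _)).
  have der_de : derivation (d - e).
    by rewrite addrC -scaleN1r; apply: derivationZD.
  have: fX (d - e) \in (fX @: <<sL>>)%VS.
    rewrite limg_span fXL fXE; apply: spanL => //.
    by rewrite !ffunE eqY subrr.
  case/memv_imgP=> c sLc; rewrite !fXE => eqX.
  have der_c : derivation c.
    by apply/mem_Der/(subvP sub_s); rewrite span_cat (subvP (addvSl _ _)).
  have cY : c Y = 0.
    have: fY c \in (fY @: <<sL>>)%VS by rewrite memv_img.
    rewrite fYE; suff ->: (fY @: <<sL>> = 0)%VS by rewrite memv0 => /eqP.
    apply/eqP; rewrite -subv0 limg_span; apply/span_subvP=> _ /mapP[b sLb ->].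
    by rewrite fYL ?mem0v.
  have -> : d = c + e.
    apply/eqP; rewrite -subr_eq; apply/eqP/ffunP.
    apply: (derivation_unique oF gen_xy der_de der_c).
      by rewrite -[LHS]mulr1 -[RHS]mulr1 -Y2 !mulrA eqX.
    by rewrite cY !ffunE eqY subrr.
  exact: memv_add.
have basis_s : basis_of (Der F gT) (sL ++ sQ).
  rewrite /basis_of eqEsubv sub_s sup_s /=.
  by apply: (free_cat_ker fYL); rewrite ?fYQ // (@free_preim _ _ _ fX) ?fXL.
split; last by rewrite /Der_basis sE.
by rewrite -(span_basis basis_s) (eqP (basis_free basis_s)) size_cat !size_map.
Qed.

End DerivationBasis.

(** * The centralizer of a reflection *)

Section ReflectionCentralizer.

Variables (gT : finGroupType) (n : nat) (x : gT).

(** Conjugation by y sends x^i y^b to x^(n-i) y^b, so that the exponents up to n/2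
    represent every orbit once; for n odd, n./2 is (n-1)/2. *)
Definition orbit_reps (y : gT) : seq gT :=
  [seq (x ^+ i)%g | i <- iota 0 n./2.+1] ++
  [seq (x ^+ i * y)%g | i <- iota 0 n./2.+1].

Lemma mem_orbit_reps y g : reflect
  (exists i (b : bool), (i.*2 <= n)%N /\ g = (x ^+ i * y ^+ b)%g)
  (g \in orbit_reps y).
Proof.
have le_iota i : (i \in iota 0 n./2.+1) = (i.*2 <= n)%N.
  by rewrite mem_iota; lia.
rewrite mem_cat; apply: (iffP orP).
  by case=> /mapP[i]; rewrite le_iota => le_i ->; exists i;
    [exists false; rewrite mulg1 | exists true].
case=> i [[] [le_i ->]]; [right | left; rewrite mulg1];
  by apply/mapP; exists i; rewrite ?le_iota.
Qed.

Variable y : gT.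
Hypotheses (n_gt2 : (2 < n)%N) (oG : #|gT| = n.*2).
Hypothesis gen_xy : dihedral_generators n x y.

Let n_gt0 : (0 < n)%N. Proof. by apply: leq_trans n_gt2. Qed.
Let yV : (y^-1 = y)%g := dihedral_invy gen_xy.

Lemma orbit_reps_transversal : orbit_transversal y (orbit_reps y).
Proof.
have conj_word i (b : bool) : ((x ^+ i * y ^+ b) ^ y = x ^- i * y ^+ b)%g.
  by rewrite conjMg (dihedral_conjXy gen_xy) conjXg conjgE mulKg.
split.
- rewrite cat_uniq !map_inj_in_uniq ?iota_uniq ?andbT.
  + apply/hasP=> -[_ /mapP[i _ ->] /mapP[j _ /esym eq_ij]].
    have := @dihedral_repr_inj _ _ _ _ gen_xy n_gt0 oG j i false true.
    by rewrite mulg1 => /(_ eq_ij)[].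
  + move=> i j; rewrite !mem_iota => lt_i lt_j /mulIg eq_ij.
    have [] := @dihedral_repr_inj _ _ _ _ gen_xy n_gt0 oG i j false false.
      by rewrite !mulg1.
    by rewrite !modn_small //; lia.
  move=> i j; rewrite !mem_iota => lt_i lt_j eq_ij.
  have [] := @dihedral_repr_inj _ _ _ _ gen_xy n_gt0 oG i j false false.
    by rewrite !mulg1.
  by rewrite !modn_small //; lia.
- move=> g; have [i [b [lt_in ->]]] := dihedral_repr gen_xy n_gt0 g.
  have [le_i|lt_i] := leqP i.*2 n.
    exists (x ^+ i * y ^+ b)%g; last exact: mem_head.
    by apply/mem_orbit_reps; exists i, b.
  exists (x ^+ (n - i) * y ^+ b)%g.
    by apply/mem_orbit_reps; exists (n - i)%N, b; split=> //; lia.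
  rewrite !inE conj_word (dihedral_invX gen_xy) ?leq_subr // subKn ?eqxx ?orbT //.
  exact: ltnW.
move=> _ _ /mem_orbit_reps[i [b [le_i ->]]] /mem_orbit_reps[j [c [le_j ->]]].
rewrite !inE conj_word => /orP[/eqP-> // | /eqP].
rewrite (dihedral_invX gen_xy); last by lia.
case/(dihedral_repr_inj gen_xy n_gt0 oG)=> eq_ij <-; congr (_ ^+ _ * _)%g.
case: i => [|i] in le_i eq_ij *.
  by move: eq_ij; rewrite subn0 modnn modn_small //; lia.
by move: eq_ij; rewrite !modn_small; lia.
Qed.

Variable F : finFieldType.
Local Notation A := (galg F gT).
Local Notation X := (gelt x : A).
Local Notation Y := (gelt y : A).
Local Notation rotsum i := (orbit_sum F y (x ^+ i)%g).

Lemma geltX (g : gT) i : gelt (g ^+ i)%g = gelt g ^+ i :> A.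
Proof. by elim: i => // i IHi; rewrite expgS geltM IHi exprS. Qed.

Lemma orbit_sum_mulr g : orbit_sum F y (g * y)%g = orbit_sum F y g * Y.
Proof.
apply/ffunP=> h; rewrite galg_mul_geltr !ffunE !inE conjMg [(y ^ y)%g]conjgE mulKg.
by rewrite -!(can2_eq (mulgKV y) (mulgK y)).
Qed.

Lemma rotsum0 : rotsum 0 = 1.
Proof. by rewrite orbit_sum_fixed ?conj1g. Qed.

Lemma rotsum_half : ~~ odd n -> rotsum n./2 = X ^+ n./2.
Proof.
move=> even_n; rewrite orbit_sum_fixed ?geltX //.
rewrite (dihedral_conjXy gen_xy) (dihedral_invX gen_xy); last by lia.
by congr (_ ^+ _)%g; lia.
Qed.

Lemma rotsum_xsym i : (0 < i)%N -> (i.*2 < n)%N -> rotsum i = xsym F x i.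
Proof.
move=> i_gt0 lt_in; rewrite orbit_sum_moved (dihedral_conjXy gen_xy) //.
rewrite (dihedral_invX gen_xy); last by lia.
apply/eqP=> eq_i.
have [] := @dihedral_repr_inj _ _ _ _ gen_xy n_gt0 oG (n - i) i false false.
  by rewrite !mulg1.
by rewrite !modn_small; lia.
Qed.

Lemma orbit_sum_reps :
  [seq orbit_sum F y g | g <- orbit_reps y] =
  [seq rotsum i | i <- iota 0 n./2.+1] ++
  [seq rotsum i * Y | i <- iota 0 n./2.+1].
Proof.
rewrite map_cat -!map_comp; congr (_ ++ _); apply: eq_map => i /=.
exact: orbit_sum_mulr.
Qed.

Lemma rotsums_even : ~~ odd n ->
  [seq rotsum i | i <- iota 0 n./2.+1] =
    1 :: rcons [seq xsym F x i | i <- iota 1 n./2.-1] (X ^+ n./2).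
Proof.
move=> even_n; rewrite [iota _ _]/= [map _ _]/= rotsum0; congr (_ :: _).
have -> : iota 1 n./2 = rcons (iota 1 n./2.-1) n./2.
  have [k ->] : exists k, n./2 = k.+1 by exists n./2.-1; lia.
  by rewrite -[in LHS](addn1 k) iotaD cats1 add1n.
rewrite map_rcons rotsum_half //; congr rcons.
apply/eq_in_map=> i; rewrite mem_iota => lt_i.
by apply: rotsum_xsym; lia.
Qed.

Lemma rotsums_odd : odd n ->
  [seq rotsum i | i <- iota 0 n./2.+1] =
    1 :: [seq xsym F x i | i <- iota 1 n./2].
Proof.
move=> odd_n; rewrite [iota _ _]/= [map _ _]/= rotsum0; congr (_ :: _).
apply/eq_in_map=> i; rewrite mem_iota => lt_i.
by apply: rotsum_xsym; lia.
Qed.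

Lemma orbit_sum_reps_odd : odd n ->
  [seq orbit_sum F y g | g <- orbit_reps y] =
    1 :: [seq xsym F x i | i <- iota 1 n./2] ++
    Y :: [seq xsym F x i * Y | i <- iota 1 n./2].
Proof.
move=> odd_n; rewrite orbit_sum_reps (map_comp ( *%R^~ Y)).
by rewrite rotsums_odd //= mul1r -map_comp.
Qed.

Section Basis.

Variable s : seq A.
Hypothesis orb_s : perm_eq s [seq orbit_sum F y g | g <- orbit_reps y].

Lemma centralizer_free : free s.
Proof.
rewrite (perm_free orb_s); apply: orbit_sum_free orbit_reps_transversal.
Qed.

Lemma centralizer_span a : a * Y = Y * a -> a \in <<s>>%VS.
Proof.
move=> aY; rewrite (eq_span (perm_mem orb_s)).
rewrite (orbit_sum_expand yV orbit_reps_transversal aY) big_seq.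
by apply: memv_suml => g rg; rewrite memvZ // memv_span // map_f.
Qed.

Lemma centralizer_comm a : a \in s -> a * Y = Y * a.
Proof.
by rewrite (perm_mem orb_s) => /mapP[g _ ->]; apply: orbit_sum_comm.
Qed.

End Basis.

Lemma perm_Be_y : ~~ odd n ->
  perm_eq (Be_y F x y n) [seq orbit_sum F y g | g <- orbit_reps y].
Proof.
move=> even_n; rewrite orbit_sum_reps (map_comp ( *%R^~ Y)).
have xsymY : map ( *%R^~ Y) [seq xsym F x i | i <- iota 1 n./2.-1] =
    [seq xsym F x i * Y | i <- iota 1 n./2.-1] by rewrite -map_comp.
rewrite rotsums_even //= map_rcons xsymY mul1r -!cats1.
by apply/seq.permP=> P; rewrite /Be_y /= !count_cat /= !count_cat /=; lia.
Qed.

End ReflectionCentralizer.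

(** * The relation x^n = 1, for n even and for n odd *)

Section DihedralCases.

Variables (m n : nat) (F : finFieldType) (gT : finGroupType) (x y : gT).
Hypotheses (n_gt2 : (2 < n)%N) (oF : #|F| = (2 ^ m)%N) (oG : #|gT| = n.*2).
Hypothesis gen_xy : dihedral_generators n x y.
Local Notation A := (galg F gT).
Local Notation X := (gelt x : A).
Local Notation Y := (gelt y : A).
Implicit Types (a f p : A) (d : A -> A).

Let n_gt0 : (0 < n)%N. Proof. by apply: leq_trans n_gt2. Qed.
Let gen_xxy : dihedral_generators n x (x * y)%g := dihedral_generators_mul gen_xy.

Lemma galg_addrr a : a + a = 0.
Proof.
have m_gt0 : (0 < m)%N.
  by case: m oF => // /eqP; rewrite eqn_leq leqNgt card_finNzRing_gt1.
have ch2 : 2%N \in [pchar F] by apply: card_finPcharP oF _.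
by rewrite -mulr2n -scaler_nat (pcharf0 ch2) scale0r.
Qed.

Lemma galg_mulrn_odd a k : odd k -> a *+ k = a.
Proof.
move=> odd_k; rewrite -[k]odd_double_half odd_k -muln2 mulnC mulrnDr mulrnA.
by rewrite mulr2n galg_addrr mul0rn addr0.
Qed.

Lemma gelt_mulYY : Y * Y = 1.
Proof. by have [_ _ y2 _] := gen_xy; rewrite -geltM -(expgS y 1) y2 gelt1. Qed.

Lemma gelt_expXn : X ^+ n = 1.
Proof. by have [_ xn _ _] := gen_xy; rewrite -geltX xn gelt1. Qed.

Lemma gelt_mulXYXY : X * Y * (X * Y) = 1.
Proof.
by have [_ _ _ xy2] := gen_xy; rewrite -!geltM -(expgS (x * y)%g 1) xy2 gelt1.
Qed.

Lemma gelt_mulYXn i : (i <= n)%N -> Y * X ^+ (n - i) = X ^+ i * Y.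
Proof.
move=> le_in; rewrite -!geltX -!geltM -(dihedral_invX gen_xy le_in).
by rewrite conjgCV (dihedral_invy gen_xy) -(dihedral_conjXy gen_xy)
  -{2}(dihedral_invy gen_xy) conjgK.
Qed.

(** The derivative of u^2 = 1 in characteristic 2. *)
Lemma derivation_involution d (u : A) : derivation d -> u * u = 1 ->
  d u * u = u * d u.
Proof.
move=> der_d u2; have [_ dM] := der_d; apply/(addIr (u * d u)).
by rewrite -dM u2 derivation1 // galg_addrr.
Qed.

Lemma derivation_Y_comm d : derivation d -> d Y * Y = Y * d Y.
Proof. by move/derivation_involution; apply; apply: gelt_mulYY. Qed.

Lemma derivation_XY_comm d : derivation d -> d Y = 0 ->
  d X * Y * gelt (x * y)%g = gelt (x * y)%g * (d X * Y).
Proof.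
move=> der_d dY; have := derivation_involution der_d gelt_mulXYXY.
by case: der_d => _ dM; rewrite dM dY mulr0 addr0 geltM.
Qed.

Lemma xsym_commX i : xsym F x i * X = X * xsym F x i.
Proof.
have comm_x : commute x (x ^- i)%g := commuteV (commuteX i (commute_refl x)).
by rewrite mulrDl mulrDr -!geltM -expgSr -expgS comm_x.
Qed.

Lemma Be_xyE : Be_xy F x y n = Be_y F x (x * y)%g n.
Proof.
rewrite /Be_xy /Be_y geltM mulrA; congr (_ ++ (_ ++ _)).
by apply: eq_map => i; rewrite -xsym_commX mulrA.
Qed.

Section Even.

Hypothesis even_n : ~~ odd n.

Lemma gelt_expX_half_central p : p * X ^+ n./2 = X ^+ n./2 * p.
Proof.
rewrite -geltX; apply/eqP/gelt_commP=> g; congr (p _); apply/conjg_fixP/commgP.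
have [i [b [_ ->]]] := dihedral_repr gen_xy n_gt0 g.
apply/commute_sym/commuteM; first exact/commute_sym/commuteX2.
case: b; last exact: commute1.
apply/commgP/conjg_fixP; rewrite (dihedral_conjXy gen_xy) (dihedral_invX gen_xy).
  by congr (_ ^+ _)%g; lia.
by lia.
Qed.

(** For n even the relation x^n = 1 is the square of x^(n/2), a central element:
    in characteristic 2 its derivative vanishes whatever the value on x. *)
Lemma dual_X_even p : dual_mx X p ^+ n = 1.
Proof.
have -> : n = (n./2 * 2)%N by lia.
rewrite exprM dual_mxX expr2 dual_mxM.
rewrite [X in dual_mx _ (_ + X)]gelt_expX_half_central galg_addrr -exprD.
have -> : (n./2 + n./2 = n)%N by lia.
by rewrite gelt_expXn dual_mx1.
Qed.

(** The centralizer bases of xy and of y, the latter lifted by w |-> (xwy, w). *)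
Lemma Der_basis_even :
  \dim (Der F gT) = (2 * n + 4)%N /\ Der_basis x y (even_pairs F x y n).
Proof.
have permB := perm_Be_y n_gt2 oG gen_xy F even_n.
have permBx := perm_Be_y n_gt2 oG gen_xxy F even_n.
have unzipQ : unzip2 [seq (X * w * Y, w) | w <- Be_y F x y n] = Be_y F x y n.
  by rewrite /unzip2 -map_comp -[RHS]map_id.
have := @Der_basis_of_extension F gT x y m n oF gen_xy (Be_xy F x y n)
  [seq (X * w * Y, w) | w <- Be_y F x y n].
case; first 1 last.
- move=> _ /mapP[w Bw ->] /=.
  have wY := centralizer_comm gen_xy permB Bw.
  apply: dihedral_derivation_exists_char2 gen_xy n_gt0 oG galg_addrr _ _ _ wY _.
    exact: dual_X_even.
  by rewrite -[X * w * Y * Y]mulrA gelt_mulYY mulr1 galg_addrr mul0r mulr0.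
- by rewrite Be_xyE; apply: centralizer_free n_gt2 oG gen_xxy _ _ permBx.
- by rewrite unzipQ; apply: centralizer_free n_gt2 oG gen_xy _ _ permB.
- move=> d der_d dY; rewrite Be_xyE; apply: (centralizer_span _ _ _ permBx) => //.
  exact: derivation_XY_comm.
- move=> d der_d; rewrite unzipQ; apply: (centralizer_span _ _ _ permB) => //.
  exact: derivation_Y_comm.
- move=> ->; split=> //.
  by rewrite /Be_xy /Be_y !(size_cat, size_map, size_iota) /=; lia.
move=> l; rewrite Be_xyE => Bl; have := centralizer_comm gen_xxy permBx Bl.
rewrite geltM => lXY.
apply: dihedral_derivation_exists_char2 gen_xy n_gt0 oG galg_addrr _ _ _ _ _.
- exact: dual_X_even.
- by rewrite mul0r mulr0.
by rewrite mulr0 addr0 -[l * Y * Y]mulrA gelt_mulYY mulr1.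
Qed.

End Even.

Section Odd.

Hypothesis odd_n : odd n.

(** The sum of all rotations, enumerated as the squares of rotations since n is
    odd; in this form it is what the derivative of x^n produces on reflections
    (rot_norm_mulY). *)
Definition rot_norm : A := \sum_(j < n) X ^+ (j.*2).

Lemma rot_norm_mulX k : X ^+ k * rot_norm = rot_norm.
Proof.
have X2 : X ^+ 2 * rot_norm = rot_norm.
  apply/eqP; rewrite -subr_eq0 -[X in _ - X]mul1r -mulrBl.
  rewrite /rot_norm (eq_bigr (fun j : 'I_n => (X ^+ 2) ^+ j)) => [|j _].
    by rewrite -subrX1 -exprM mulnC exprM gelt_expXn expr1n subrr.
  by rewrite -exprM mul2n.
have X2k i : X ^+ (i.*2) * rot_norm = rot_norm.
  by elim: i => [|i IHi]; rewrite ?mul1r // doubleS -addn2 exprD -mulrA X2.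
have X1 : X * rot_norm = rot_norm.
  rewrite -{2}(X2k n./2.+1); congr (_ * _); rewrite -[LHS]mulr1 -gelt_expXn -exprS.
  by congr (_ ^+ _); lia.
by elim: k => [|k IHk]; rewrite ?mul1r // exprSr -mulrA X1.
Qed.

Lemma rot_norm_mulY f : f * X = X * f ->
  \sum_(j < n) X ^+ j * (f * Y) * X ^+ (n - j.+1) = f * rot_norm * Y.
Proof.
move=> fX; have fXj j : X ^+ j * f = f * X ^+ j by apply/esym/commrX.
rewrite -(rot_norm_mulX 1) mulrA mulr_sumr mulr_suml; apply: eq_bigr => j _.
rewrite -!mulrA gelt_mulYXn // !mulrA fXj -!(mulrA f) -!exprD.
by congr (_ * (_ ^+ _ * _)); lia.
Qed.

Lemma dual_X_odd f : f * X = X * f -> f * rot_norm = 0 ->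
  dual_mx X (f * Y) ^+ n = 1.
Proof.
by move=> fX f0; rewrite dual_mxX rot_norm_mulY // f0 mul0r gelt_expXn dual_mx1.
Qed.

Lemma xsym_rot_norm i : (i <= n)%N -> xsym F x i * rot_norm = 0.
Proof.
move=> le_in; rewrite /xsym (dihedral_invX gen_xy le_in) !geltX mulrDl.
by rewrite !rot_norm_mulX galg_addrr.
Qed.

Lemma rot_neq_y i : (x ^+ i)%g != y.
Proof.
apply/eqP=> eq_i.
have [] // := @dihedral_repr_inj _ _ _ _ gen_xy n_gt0 oG i 0 false true.
by rewrite mulg1 mul1g.
Qed.

Lemma rot_norm_mulY_coef : (rot_norm * Y) y = 1.
Proof.
rewrite galg_mul_geltr mulgV sum_ffunE (bigD1 (Ordinal n_gt0)) //=.
rewrite big1 => [|j ne_j0].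
  by rewrite addr0 expr0 ffunE eqxx.
rewrite -geltX ffunE; case: eqP => // eq_j; case/eqP: ne_j0; apply/val_inj=> /=.
have [] := @dihedral_repr_inj _ _ _ _ gen_xy n_gt0 oG j.*2 0 false false.
  by rewrite -eq_j.
(* n divides 2j < 2n, and 2j = n is excluded by parity. *)
rewrite mod0n => /eqP; have := ltn_ord j; rewrite -/(dvdn _ _).
by move=> lt_j /dvdnP[[|[|q]]]; nia.
Qed.

(** Let mu = d(x)y, which commutes with xy. Write mu = f + f' xy with f, f'
    combinations of 1 and the x^i + x^-i, so that d(x) = f y + f' x; the relation
    x^n = 1 becomes mu(1) N y + f' = 0 with N the sum of all rotations, and the
    two terms have disjoint supports. *)
Lemma derivation_ker_odd d : derivation d -> d Y = 0 ->
  d X * Y \in <<[seq xsym F x i | i <- iota 1 n./2]>>%VS.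
Proof.
move=> der_d dY; have muXY := derivation_XY_comm der_d dY.
set mu := d X * Y in muXY *.
pose r i := orbit_sum F (x * y)%g (x ^+ i)%g.
pose f := \sum_(i <- iota 0 n./2.+1) mu (x ^+ i)%g *: r i.
pose f' := \sum_(i <- iota 0 n./2.+1) mu (x ^+ i * (x * y))%g *: r i.
have muE : mu = f + f' * (X * Y).
  rewrite {1}(orbit_sum_expand (dihedral_invy gen_xxy)
    (orbit_reps_transversal n_gt2 oG gen_xxy) muXY) big_cat !big_map.
  congr (_ + _); rewrite mulr_suml; apply: eq_bigr => i _.
  by rewrite orbit_sum_mulr geltM; apply: scalerAl.
have rE : [seq r i | i <- iota 0 n./2.+1] = 1 :: [seq xsym F x i | i <- iota 1 n./2].
  exact: rotsums_odd n_gt2 oG gen_xxy F odd_n.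
have rX i : i \in iota 0 n./2.+1 -> r i * X = X * r i.
  move=> ri; have : r i \in 1 :: [seq xsym F x i | i <- iota 1 n./2].
    by rewrite -rE map_f.
  by rewrite inE => /orP[/eqP->|/mapP[j _ ->]]; rewrite ?mulr1 ?mul1r ?xsym_commX.
have sumX (c : nat -> F) : (\sum_(i <- iota 0 n./2.+1) c i *: r i) * X =
    X * (\sum_(i <- iota 0 n./2.+1) c i *: r i).
  rewrite mulr_suml mulr_sumr !big_seq; apply: eq_bigr => i ri.
  by rewrite -scalerAl -scalerAr rX.
have fX : f * X = X * f by exact: sumX.
have f'X : f' * X = X * f' by exact: sumX.
have f'y : f' y = 0.
  rewrite sum_ffunE big1 // => i _; rewrite !ffunE !inE (dihedral_conjXy gen_xxy).
  rewrite ![y == _]eq_sym (can2_eq invgK invgK) (dihedral_invy gen_xy).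
  by rewrite (negPf (rot_neq_y i)) scaler0.
have fE : f = mu 1%g *: 1 + \sum_(i <- iota 1 n./2) mu (x ^+ i)%g *: xsym F x i.
  rewrite /f [iota _ _]/= big_cons [r 0]rotsum0; congr (_ + _).
  rewrite !big_seq; apply: eq_bigr => i; rewrite mem_iota => lt_i.
  by rewrite [r i](rotsum_xsym n_gt2 oG gen_xxy) //; lia.
have fN : f * rot_norm = mu 1%g *: rot_norm.
  rewrite fE mulrDl -scalerAl mul1r mulr_suml big_seq big1 ?addr0 // => i.
  by rewrite mem_iota => lt_i; rewrite -scalerAl xsym_rot_norm ?scaler0 //; lia.
have dXE : d X = f * Y + f' * X.
  by rewrite -[LHS]mulr1 -gelt_mulYY mulrA -/mu muE mulrDl -!mulrA gelt_mulYY mulr1.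
have rel : mu 1%g *: (rot_norm * Y) + f' = 0.
  have := derivation_dual_mxX X n der_d; rewrite dual_mxX gelt_expXn.
  rewrite (derivation1 der_d) => /dual_mx_inj[_ <-].
  under [RHS]eq_bigr do rewrite dXE mulrDr mulrDl.
  rewrite big_split /= rot_norm_mulY // fN -scalerAl; congr (_ + _).
  rewrite (eq_bigr (fun=> f')) => [|j _].
    by rewrite sumr_const card_ord galg_mulrn_odd.
  rewrite f'X mulrA -exprSr (_ : _ * f' = f' * X ^+ j.+1); last exact/esym/commrX.
  by rewrite -mulrA -exprD subnKC // gelt_expXn mulr1.
have mu1 : mu 1%g = 0.
  move/ffunP/(_ y): rel; rewrite [LHS]ffunE f'y [X in X + _]ffunE [RHS]ffunE.
  by rewrite rot_norm_mulY_coef addr0 [_ *: _]mulr1.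
have f'0 : f' = 0 by rewrite -rel mu1 scale0r add0r.
rewrite muE f'0 mul0r addr0 fE mu1 scale0r add0r big_seq.
by apply: memv_suml => i Si; rewrite memvZ // memv_span // map_f.
Qed.

(** Every pair satisfies the relation x^n = 1 because its first entry is f y with
    f zero or a sum of two rotations, whence f N = 0 in characteristic 2. *)
Lemma Der_basis_odd :
  \dim (Der F gT) = ((3 * n + 1)./2)%N /\ Der_basis x y (odd_pairs F x y n).
Proof.
set S := [seq xsym F x i | i <- iota 1 n./2].
set Q := [:: ((1 + X) * Y, 1); (0, Y)]
  ++ [seq (X * xsym F x i * Y, xsym F x i) | i <- iota 1 n./2]
  ++ [seq (0, xsym F x i * Y) | i <- iota 1 n./2].
have oddE : odd_pairs F x y n = [seq (l * Y, 0) | l <- S] ++ Q.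
  by rewrite /odd_pairs -map_comp.
have unzipQ : unzip2 Q = [:: 1; Y] ++ S ++ [seq xsym F x i * Y | i <- iota 1 n./2].
  by rewrite /unzip2 !map_cat -!map_comp.
have permQ : perm_eq (unzip2 Q) [seq orbit_sum F y g | g <- orbit_reps n x y].
  rewrite (orbit_sum_reps_odd n_gt2 oG gen_xy F odd_n).
  by apply/seq.permP=> P; rewrite unzipQ -/S /= !count_cat /=; lia.
have freeQ : free (unzip2 Q) := centralizer_free n_gt2 oG gen_xy permQ.
have Scomm l : l \in S -> l * Y = Y * l /\ l * (X * Y) = X * Y * l.
  case/mapP=> i; rewrite mem_iota => lt_i ->; split.
    rewrite -(rotsum_xsym n_gt2 oG gen_xy); try lia.
    exact: orbit_sum_comm (dihedral_invy gen_xy) _.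
  rewrite -(rotsum_xsym n_gt2 oG gen_xxy); try lia.
  by rewrite -geltM; apply: orbit_sum_comm (dihedral_invy gen_xxy) _.
have SX l : l \in S -> l * X = X * l by case/mapP=> i _ ->; apply: xsym_commX.
have SN l : l \in S -> l * rot_norm = 0.
  by case/mapP=> i; rewrite mem_iota => lt_i ->; apply: xsym_rot_norm; lia.
have exd (f w : A) : f * X = X * f -> f * rot_norm = 0 -> w * Y = Y * w ->
    (f + X * w) * (X * Y) = X * Y * (f + X * w) ->
  exists d : A -> A, [/\ derivation d, d X = f * Y & d Y = w].
  move=> fX fN wY fwXY.
  apply: dihedral_derivation_exists_char2 gen_xy n_gt0 oG galg_addrr _ _ _ wY _.
    exact: dual_X_odd.
  by rewrite -[f * Y * Y]mulrA gelt_mulYY mulr1.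
rewrite oddE; have := @Der_basis_of_extension F gT x y m n oF gen_xy S Q.
case.
- move=> l Sl; have [lY lXY] := Scomm l Sl.
  by apply: exd; rewrite ?mulr0 ?addr0 ?mul0r ?SX ?SN.
- move=> q; rewrite /Q !mem_cat !inE -!orbA.
  case/or4P=> [/eqP-> | /eqP-> | /mapP[i Si ->] | /mapP[i Si ->]] /=.
  + apply: exd.
    * by rewrite mulrDl mulrDr mul1r mulr1.
    * by rewrite mulrDl mul1r -{1}[X]expr1 rot_norm_mulX galg_addrr.
    * by rewrite mulr1 mul1r.
    by rewrite mulr1 -addrA galg_addrr addr0 mul1r mulr1.
  + have := @exd 0 Y; rewrite !mul0r => ex0; apply: ex0 => //.
      by rewrite mulr0.
    by rewrite add0r.
  + have Sl := map_f (xsym F x) Si; have [lY lXY] := Scomm _ Sl.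
    apply: exd => //; first by rewrite -mulrA SX.
      by rewrite -mulrA SN ?mulr0.
    by rewrite galg_addrr mul0r mulr0.
  have Sl := map_f (xsym F x) Si; have [lY lXY] := Scomm _ Sl.
  have := @exd 0 (xsym F x i * Y); rewrite !mul0r => ex0; apply: ex0 => //.
    by rewrite mulr0.
    by rewrite mulrA lY.
  have -> : X * (xsym F x i * Y) = xsym F x i * (X * Y) by rewrite !mulrA SX.
  by rewrite add0r lXY -mulrA lXY.
- apply: (@catl_free _ _ (1 :: Y :: [seq xsym F x i * Y | i <- iota 1 n./2])).
  rewrite (perm_free (_ : perm_eq _ (unzip2 Q))) //.
  by apply/seq.permP=> P; rewrite unzipQ -/S /= !count_cat /=; lia.
- exact: freeQ.
- exact: derivation_ker_odd.
- move=> d der_d; apply: (centralizer_span _ _ _ permQ) => //.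
  exact: derivation_Y_comm.
- move=> -> H; split=> //; rewrite /Q /S !(size_cat, size_map, size_iota) /=; lia.
Qed.

End Odd.
End DihedralCases.

Theorem theorem3p11 (m n : nat) (F : finFieldType) (x y : 'D_(n.*2)) :
  (0 < m)%N -> (2 < n)%N -> #|F| = (2 ^ m)%N -> dihedral_generators n x y ->
  (~~ odd n ->
     \dim (Der F 'D_(n.*2)) = (2 * n + 4)%N /\
     Der_basis x y (even_pairs F x y n)) /\
  (odd n ->
     \dim (Der F 'D_(n.*2)) = ((3 * n + 1)./2)%N /\
     Der_basis x y (odd_pairs F x y n)).
Proof.
move=> _ n_gt2 oF gen_xy.
have oG : #|{: 'D_(n.*2)}| = n.*2 by rewrite -cardsT card_dihedral // ltnW.
split; first exact: Der_basis_even n_gt2 oF oG gen_xy.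
exact: Der_basis_odd n_gt2 oF oG gen_xy.
Qed.
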